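(* Let $\mathbf{A}\in\mathbb{R}^{n\times n}$ with $\rho^2(\mathbf{A})\ge 1$, let $(\mathbf{A},\mathbf{C})$ be observable and $(\mathbf{A},\sqrt{\mathbf{W}})$ controllable, and let $c(i)=\mathrm{Tr}(v^i(\bar{\mathbf{P}}_0))$, $i\in\mathbb{N}$, be the estimation-error function. Then there exist constants $N>0$ and $\eta>0$ such that $$c(i)\ge \eta\,(\rho(\mathbf{A}))^{2i},\qquad\forall i>N .$$
   Context: $\rho(\cdot)$ is the spectral radius. The underlying system is $\mathbf{x}_{t+1}=\mathbf{A}\mathbf{x}_t+\mathbf{w}_t$, $\mathbf{y}_t=\mathbf{C}\mathbf{x}_t+\mathbf{v}_t$, $\mathbf{x}_t\in\mathbb{R}^n$, $\mathbf{y}_t\in\mathbb{R}^m$, with independent i.i.d. zero-mean Gaussian noises of covariances $\mathbf{W}$ and $\mathbf{V}$. Observability and controllability mean that $[\mathbf{C}^\top,\mathbf{A}^\top\mathbf{C}^\top,\dots,(\mathbf{A}^n)^\top\mathbf{C}^\top]$ and $[\sqrt{\mathbf{W}},\mathbf{A}\sqrt{\mathbf{W}},\dots,\mathbf{A}^n\sqrt{\mathbf{W}}]$ have full rank. $\bar{\mathbf{P}}_0$ is the (finite, positive semidefinite) limit as $t\to\infty$ of the posterior error covariance $\mathbf{P}^s_{t|t}$ of the Kalman filter for this system: $\mathbf{P}^s_{t|t-1}=\mathbf{A}\mathbf{P}^s_{t-1|t-1}\mathbf{A}^\top+\mathbf{W}$, $\mathbf{K}_t=\mathbf{P}^s_{t|t-1}\mathbf{C}^\top(\mathbf{C}\mathbf{P}^s_{t|t-1}\mathbf{C}^\top+\mathbf{V})^{-1}$,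 $\mathbf{P}^s_{t|t}=(\mathbf{I}-\mathbf{K}_t\mathbf{C})\mathbf{P}^s_{t|t-1}$. The map $v$ is $v(\mathbf{X})=\mathbf{A}\mathbf{X}\mathbf{A}^\top+\mathbf{W}$, with $v^1=v$, $v^{m+1}=v\circ v^m$. *)

(* Defs.v *)
From HB Require Import structures.
From mathcomp Require Import all_boot all_order all_algebra.
From mathcomp Require Import all_classical all_reals all_analysis.
From mathcomp Require Export complex.

Set Implicit Arguments.
Unset Strict Implicit.
Unset Printing Implicit Defensive.

Import Order.TTheory GRing.Theory Num.Theory.
Import numFieldNormedType.Exports.

Local Open Scope classical_set_scope.
Local Open Scope ring_scope.

(* The modulus is taken with [Normc.normc], which is real-valued; [`|z|] would
   live in R[i].  For n > 0 the set is finite and nonempty, so the supremum is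
   the maximum; for n = 0 it is sup set0 = 0. *)
Definition spectral_radius (R : realType) (n : nat) (A : 'M[R]_n) : R :=
  sup [set Normc.normc z | z in
        [set z : R[i] | eigenvalue (map_mx (real_complex R) A) z]].

Definition psdmx (R : realType) (n : nat) (X : 'M[R]_n) : Prop :=
  X^T = X /\ forall u : 'cV[R]_n, 0 <= (u^T *m X *m u) ord0 ord0.

(* The principal square root: a positive semidefinite X has exactly one
   positive semidefinite square root.  The default 0 is only taken when X is
   not positive semidefinite. *)
Definition sqrtmx (R : realType) (n : nat) (X : 'M[R]_n) : 'M[R]_n :=
  xget 0 [set S : 'M[R]_n | psdmx S /\ S *m S = X].

Definition observable (R : realType) (n m : nat)
    (A : 'M[R]_n) (C : 'M[R]_(m, n)) : Prop :=
  \rank (\mxrow_(j < n.+1) ((A ^+ j)^T *m C^T)) = n.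

Definition controllable (R : realType) (n p : nat)
    (A : 'M[R]_n) (B : 'M[R]_(n, p)) : Prop :=
  \rank (\mxrow_(j < n.+1) (A ^+ j *m B)) = n.

Definition cov_step (R : realType) (n : nat) (A W X : 'M[R]_n) : 'M[R]_n :=
  A *m X *m A^T + W.

(* In the next three definitions P is the prior covariance P_{t|t-1}. *)
Definition innovation_cov (R : realType) (n m : nat)
    (C : 'M[R]_(m, n)) (V : 'M[R]_m) (P : 'M[R]_n) : 'M[R]_m :=
  C *m P *m C^T + V.

Definition kalman_gain (R : realType) (n m : nat)
    (C : 'M[R]_(m, n)) (V : 'M[R]_m) (P : 'M[R]_n) : 'M[R]_(n, m) :=
  P *m C^T *m invmx (innovation_cov C V P).

Definition meas_update (R : realType) (n m : nat)
    (C : 'M[R]_(m, n)) (V : 'M[R]_m) (P : 'M[R]_n) : 'M[R]_n :=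
  (1%:M - kalman_gain C V P *m C) *m P.

(* P_{t|t}, started from the initial covariance P_{0|0} = Sigma0. *)
Fixpoint posterior_cov (R : realType) (n m : nat) (A : 'M[R]_n)
    (C : 'M[R]_(m, n)) (W : 'M[R]_n) (V : 'M[R]_m) (Sigma0 : 'M[R]_n)
    (t : nat) : 'M[R]_n :=
  if t is t'.+1 then
    meas_update C V (cov_step A W (posterior_cov A C W V Sigma0 t'))
  else Sigma0.

(* P_{t+1|t}. *)
Definition prior_cov (R : realType) (n m : nat) (A : 'M[R]_n)
    (C : 'M[R]_(m, n)) (W : 'M[R]_n) (V : 'M[R]_m) (Sigma0 : 'M[R]_n)
    (t : nat) : 'M[R]_n :=
  cov_step A W (posterior_cov A C W V Sigma0 t).

Definition est_error (R : realType) (n : nat) (A W Pbar0 : 'M[R]_n)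
    (i : nat) : R :=
  \tr (iter i (cov_step A W) Pbar0).

(* Main.v *)
(* For a maximal eigenvalue z of A and a left eigenvector w, the row w A^i S
   (with S S = W) equals z^i w S, and controllability forces w S to be nonzero.
   Hence |w S|^2 |z|^(2i) <= |w|^2 |A^i S|^2, where |A^i S|^2 is the trace of
   A^i W (A^i)^T, the oldest noise term of v^(i+1)(Pbar0).  The remaining terms have
   nonnegative trace.  Real and imaginary parts of w are handled separately. *)
Require Import Defs.
From HB Require Import structures.
From mathcomp Require Import all_boot all_order all_algebra.
From mathcomp Require Import all_classical all_reals all_analysis.
From mathcomp Require Import ring.

Set Implicit Arguments.
Unset Strict Implicit.
Unset Printing Implicit Defensive.

Import Order.TTheory GRing.Theory Num.Theory.
Import numFieldNormedType.Exports.

Local Open Scope classical_set_scope.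
Local Open Scope ring_scope.

Definition sqfrob (R : realType) (m n : nat) (M : 'M[R]_(m, n)) : R :=
  \sum_i \sum_j M i j ^+ 2.

(** Positivity without the symmetry clause of [psdmx]: this is the property carried through the
    Kalman recursion, its limit and the trace. *)
Definition form_ge0 (R : realType) (n : nat) (X : 'M[R]_n) : Prop :=
  forall u : 'cV[R]_n, 0 <= (u^T *m X *m u) ord0 ord0.

(** * Squared Frobenius norms and real pairs standing for complex rows *)

Lemma sqfrob_ge0 (R : realType) (m n : nat) (M : 'M[R]_(m, n)) :
  0 <= sqfrob M.
Proof. by apply: sumr_ge0 => i _; apply: sumr_ge0 => j _; exact: sqr_ge0. Qed.

Lemma sqfrob_eq0 (R : realType) (m n : nat) (M : 'M[R]_(m, n)) :
  sqfrob M = 0 -> M = 0.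
Proof.
move=> M0; apply/matrixP => i j; rewrite mxE.
have sq_ge0 k : 0 <= \sum_l M k l ^+ 2.
  by apply: sumr_ge0 => l _; exact: sqr_ge0.
have /(psumr_eq0P (fun k _ => sq_ge0 k)) /(_ i isT) Mi0 := M0.
have /(psumr_eq0P (fun l _ => sqr_ge0 (M i l))) /(_ j isT) /eqP := Mi0.
by rewrite sqrf_eq0 => /eqP.
Qed.

Lemma sqfrob_tr (R : realType) (m n : nat) (M : 'M[R]_(m, n)) :
  sqfrob M = \tr (M *m M^T).
Proof.
rewrite /mxtrace; apply: eq_bigr => i _; rewrite mxE.
by apply: eq_bigr => j _; rewrite mxE expr2.
Qed.

Lemma sum_cauchy_schwarz (R : realType) (n : nat) (a b : 'I_n -> R) :
  (\sum_i a i * b i) ^+ 2 <= (\sum_i a i ^+ 2) * (\sum_i b i ^+ 2).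
Proof.
(* Lagrange's identity *)
have lagrange : \sum_i \sum_j (a i * b j - a j * b i) ^+ 2 =
    2 * ((\sum_i a i ^+ 2) * (\sum_i b i ^+ 2) - (\sum_i a i * b i) ^+ 2).
  transitivity (\sum_i \sum_j (a i ^+ 2 * b j ^+ 2) +
                \sum_i \sum_j (b i ^+ 2 * a j ^+ 2) -
                2 * \sum_i \sum_j ((a i * b i) * (a j * b j))).
    rewrite mulr_sumr -big_split /= -sumrB; apply: eq_bigr => i _.
    rewrite mulr_sumr -big_split /= -sumrB; apply: eq_bigr => j _.
    by ring.
  by rewrite -!big_distrlr /=; ring.
have : 0 <= \sum_i \sum_j (a i * b j - a j * b i) ^+ 2.
  by apply: sumr_ge0 => i _; apply: sumr_ge0 => j _; exact: sqr_ge0.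
by rewrite lagrange pmulr_rge0 // subr_ge0.
Qed.

(** Cauchy-Schwarz applied to [a] and each column of [G], then summed over the columns. *)
Lemma sqfrob_row_mul (R : realType) (n p : nat) (a : 'rV[R]_n)
    (G : 'M[R]_(n, p)) :
  sqfrob (a *m G) <= sqfrob a * sqfrob G.
Proof.
rewrite /sqfrob !big_ord1 [X in _ <= _ * X]exchange_big /=.
rewrite mulr_sumr; apply: ler_sum => j _; rewrite mxE.
exact: sum_cauchy_schwarz.
Qed.

(** The two matrices on the left are the real and imaginary parts of (x + iy)(u + iv); their cross
    terms cancel entrywise. *)
Lemma sqfrob_rotation (R : realType) (m n : nat) (x y : R)
    (u v : 'M[R]_(m, n)) :
  sqfrob (x *: u - y *: v) + sqfrob (x *: v + y *: u) =
  (x ^+ 2 + y ^+ 2) * (sqfrob u + sqfrob v).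
Proof.
rewrite /sqfrob -!big_split mulr_sumr /=; apply: eq_bigr => i _.
rewrite -!big_split mulr_sumr /=; apply: eq_bigr => j _.
by rewrite !mxE; ring.
Qed.

(** The hypotheses say that a + ib is a left eigenvector for x + iy, so by [sqfrob_rotation] each
    factor [A] contributes one squared modulus. *)
Lemma sqfrob_eigen_iter (R : realType) (n p : nat) (A : 'M[R]_n)
    (S : 'M[R]_(n, p)) (a b : 'rV[R]_n) (x y : R) (j : nat) :
  a *m A = x *: a - y *: b -> b *m A = x *: b + y *: a ->
  sqfrob (a *m (A ^+ j *m S)) + sqfrob (b *m (A ^+ j *m S)) =
  (x ^+ 2 + y ^+ 2) ^+ j * (sqfrob (a *m S) + sqfrob (b *m S)).
Proof.
move=> aA bA; elim: j => [|j IH]; first by rewrite !expr0 !mul1mx mul1r.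
rewrite (exprS A) (exprS (_ + _)) -!mulmxA !(mulmxA _ A) aA bA.
rewrite mulmxBl mulmxDl -!scalemxAl sqfrob_rotation IH.
by rewrite mulrA.
Qed.

(** Such an [a] annihilates the whole controllability matrix, whose rows are independent because its
    rank is [n]. *)
Lemma controllable_left_kernel (R : realType) (n p : nat) (A : 'M[R]_n)
    (B : 'M[R]_(n, p)) (a : 'rV[R]_n) :
  controllable A B -> (forall j, a *m (A ^+ j *m B) = 0) -> a = 0.
Proof.
move=> ctrl aB0; have ctrl_free : row_free (\mxrow_(j < n.+1) (A ^+ j *m B)).
  by rewrite /row_free ctrl.
apply: (row_free_inj ctrl_free) => /=; rewrite mul0mx mul_mxrow.
by under eq_mxrow do rewrite aB0; rewrite mxrow0.
Qed.

(** * Nonnegative quadratic forms along the Kalman recursion *)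

Lemma form_ge0_conj (R : realType) (m n : nat) (B : 'M[R]_(m, n))
    (X : 'M[R]_n) :
  form_ge0 X -> form_ge0 (B *m X *m B^T).
Proof.
move=> X0 u; have := X0 (B^T *m u).
by rewrite trmx_mul trmxK !mulmxA.
Qed.

Lemma form_ge0D (R : realType) (n : nat) (X Y : 'M[R]_n) :
  form_ge0 X -> form_ge0 Y -> form_ge0 (X + Y).
Proof. by move=> X0 Y0 u; rewrite mulmxDr mulmxDl mxE addr_ge0. Qed.

Lemma form_ge0_tr (R : realType) (n : nat) (X : 'M[R]_n) :
  form_ge0 X -> 0 <= \tr X.
Proof.
move=> X0; apply: sumr_ge0 => i _; have := X0 (delta_mx i ord0).
by rewrite trmx_delta -rowE -colE !mxE.
Qed.

Lemma form_ge0_lim (R : realType) (n : nat) (X : nat -> 'M[R]_n)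
    (L : 'M[R]_n) :
  (forall t, form_ge0 (X t)) -> X t @[t --> \oo] --> L -> form_ge0 L.
Proof.
move=> X0 XL u.
have formE (Y : 'M[R]_n) : (u^T *m Y *m u) ord0 ord0 =
    \sum_j (\sum_i u^T ord0 i * Y i j) * u j ord0.
  by rewrite mxE; apply: eq_bigr => j _; rewrite mxE.
have : (u^T *m X t *m u) ord0 ord0 @[t --> \oo] --> (u^T *m L *m u) ord0 ord0.
  rewrite formE; under eq_fun do rewrite formE.
  apply: cvg_big => [|j _]; first exact: add_continuous.
  apply: cvgMl; apply: cvg_big => [|i _]; first exact: add_continuous.
  apply: cvgMr; apply: (cvg_comp _ (fun M : 'M[R]_n => M i j) XL).
  exact: coord_continuous.
apply: (closed_cvg (fun r : R => 0 <= r) (@closed_ge R 0)).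
by apply: nearW => t; exact: X0.
Qed.

(* Joseph form: (I - K C) P = (I - K C) P (I - K C)^T + K V K^T. *)
Lemma form_ge0_meas_update (R : realType) (n m : nat) (C : 'M[R]_(m, n))
    (V : 'M[R]_m) (P : 'M[R]_n) :
  innovation_cov C V P \in unitmx -> form_ge0 V -> form_ge0 P ->
  form_ge0 (meas_update C V P).
Proof.
move=> invU V0 P0; rewrite /meas_update.
set K := kalman_gain C V P.
have KS : K *m innovation_cov C V P = P *m C^T by rewrite mulmxKV.
set M := (1%:M - K *m C) *m P.
(* Expanding the innovation in [KS] isolates [K *m V]. In the Joseph form this makes K V K^T cancel
   the term - M C^T K^T. *)
have KV : K *m V = M *m C^T.
  rewrite /M mulmxBl mul1mx mulmxBl -KS /innovation_cov mulmxDr !mulmxA.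
  by rewrite addrC addKr.
have -> : M = M *m (1%:M - K *m C)^T + K *m V *m K^T.
  by rewrite linearB /= trmx1 trmx_mul mulmxBr mulmx1 KV mulmxA subrK.
by apply: form_ge0D; exact: form_ge0_conj.
Qed.

Lemma form_ge0_cov_step (R : realType) (n : nat) (A W X : 'M[R]_n) :
  form_ge0 W -> form_ge0 X -> form_ge0 (cov_step A W X).
Proof. by move=> W0 X0; apply: form_ge0D => //; exact: form_ge0_conj. Qed.

(** The subtracted term is the noise injected by the first step and transported by [i] more; each
    further step conjugates the difference by [A] and adds [W]. *)
Lemma form_ge0_iter_cov_step (R : realType) (n : nat) (A W X : 'M[R]_n)
    (i : nat) :
  form_ge0 W -> form_ge0 X ->
  form_ge0 (iter i.+1 (cov_step A W) X - A ^+ i *m W *m (A ^+ i)^T).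
Proof.
move=> W0 X0; elim: i => [|i IH].
  by rewrite expr0 mul1mx trmx1 mulmx1 /= addrK; exact: form_ge0_conj.
have -> : iter i.+2 (cov_step A W) X - A ^+ i.+1 *m W *m (A ^+ i.+1)^T =
    A *m (iter i.+1 (cov_step A W) X - A ^+ i *m W *m (A ^+ i)^T) *m A^T + W.
  rewrite iterS {1}/cov_step exprS trmx_mul mulmxBr mulmxBl !mulmxA.
  by rewrite addrAC.
by apply: form_ge0D => //; exact: form_ge0_conj.
Qed.

(** * Attainment of the spectral radius and real form of an eigenvector *)

Lemma seq_maximum (R : realType) (x : R) (s : seq R) :
  exists2 M, M \in x :: s & forall y, y \in x :: s -> y <= M.
Proof.
elim: s x => [|z s IH] x.
  by exists x => [|y]; rewrite !inE // => /eqP ->.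
have [M Ms leM] := IH z; exists (Num.max x M).
  by case: leP; rewrite !inE ?eqxx // -in_cons Ms orbT.
move=> y; rewrite in_cons => /predU1P[->|/leM yM]; rewrite le_max ?lexx //.
by rewrite yM orbT.
Qed.

Lemma sup_mem_seq (R : realType) (E : set R) (s : seq R) :
  E !=set0 -> (forall x, E x -> x \in s) -> E (sup E).
Proof.
move=> [x Ex] Es; pose s' := [seq y <- s | `[< E y >]].
have [M Ms leM] := seq_maximum x s'.
have EM : E M.
  by move: Ms; rewrite in_cons mem_filter => /predU1P[->//|/andP[/asboolP]].
suff -> : sup E = M by [].
have ubM : ubound E M.
  move=> y Ey; apply: leM; rewrite in_cons mem_filter Es // andbT.
  by apply/orP; right; apply/asboolP.
apply/eqP; rewrite eq_le ge_sup /=; [|by exists x|by []].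
by apply: ub_le_sup EM; exists M.
Qed.

(** The eigenvalues are among the finitely many roots of the characteristic polynomial, which splits
    over [R[i]]. A nonzero supremum rules out an empty spectrum, since [sup set0] is 0. *)
Lemma spectral_radius_attained (R : realType) (n : nat) (A : 'M[R]_n) :
  spectral_radius A != 0 ->
  exists2 z : R[i], eigenvalue (map_mx (real_complex R) A) z &
    spectral_radius A = Normc.normc z.
Proof.
rewrite /spectral_radius; set Ac := map_mx _ A; set E := image _ _ => rho0.
have E0 : E !=set0.
  by apply/set0P; apply: contra_neq rho0 => ->; rewrite sup0.
have [rs charE] := closed_field_poly_normal (char_poly Ac).
have /(sup_mem_seq E0)[z zE <-] :
    forall x, E x -> x \in map (@Normc.normc R) rs.
  move=> _ [z /= zE <-]; apply: map_f.
  move: zE; rewrite eigenvalue_root_char charE rootZ ?root_prod_XsubC //.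
  by rewrite lead_coef_eq0 monic_neq0 // char_poly_monic.
by exists z.
Qed.

Lemma eigenvalue_real_imag (R : realType) (n : nat) (A : 'M[R]_n) (z : R[i]) :
  eigenvalue (map_mx (real_complex R) A) z ->
  exists a b : 'rV[R]_n, [/\ (a != 0) || (b != 0),
    a *m A = complex.Re z *: a - complex.Im z *: b &
    b *m A = complex.Re z *: b + complex.Im z *: a].
Proof.
case/eigenvalueP => w wA w0.
pose a := map_mx (@complex.Re R) w; pose b := map_mx (@complex.Im R) w.
have wE : w = map_mx (real_complex R) a + 'i%C *: map_mx (real_complex R) b.
  by apply/matrixP => i j; rewrite !mxE -complexE.
have entry j : \sum_k w 0 k * (A k j)%:C%C = z * w 0 j.
  have /matrixP/(_ 0 j) := wA; rewrite !mxE => <-.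
  by apply: eq_bigr => k _; rewrite mxE.
(* As [A] is real, multiplying by it commutes with taking real and imaginary parts. *)
have sumE j : \sum_k w 0 k * (A k j)%:C%C =
    Complex (\sum_k a 0 k * A k j) (\sum_k b 0 k * A k j).
  elim/big_rec3: _ => [//|k s t u _ ->].
  by rewrite !mxE; case: (w 0 k) => p q; apply/eqP; rewrite eq_complex /=;
    apply/andP; split; apply/eqP; ring.
exists a, b; split.
- apply: contraNT w0; rewrite negb_or !negbK => /andP[/eqP a0 /eqP b0].
  by rewrite wE a0 b0 !map_mx0 scaler0 addr0.
- apply/rowP => j; rewrite [LHS]mxE; have := congr1 (@complex.Re R) (entry j).
  by rewrite sumE /= => ->; rewrite !mxE; case: z (w 0 j) {wA entry} => p q [].
- apply/rowP => j; rewrite [LHS]mxE; have := congr1 (@complex.Im R) (entry j).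
  by rewrite sumE /= => ->; rewrite !mxE; case: z (w 0 j) {wA entry} => p q [].
Qed.

Theorem proposition2 (R : realType) (n m : nat)
    (A : 'M[R]_n) (C : 'M[R]_(m, n)) (W : 'M[R]_n) (V : 'M[R]_m)
    (Sigma0 Pbar0 : 'M[R]_n)
    (W_psd : psdmx W) (V_psd : psdmx V) (Sigma0_psd : psdmx Sigma0)
    (innovation_unit : forall t : nat,
       innovation_cov C V (prior_cov A C W V Sigma0 t) \in unitmx)
    (Pbar0_lim : posterior_cov A C W V Sigma0 t @[t --> \oo] --> Pbar0)
    (rhoA_ge1 : 1 <= spectral_radius A ^+ 2)
    (AC_obs : observable A C)
    (AW_ctrl : controllable A (sqrtmx W)) :
  exists (N : nat) (eta : R),
    [/\ (0 < N)%N, 0 < eta &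
        forall i : nat, (N < i)%N ->
          eta * spectral_radius A ^+ (2 * i) <= est_error A W Pbar0 i].
Proof.
set rho := spectral_radius A in rhoA_ge1 *.
have rho2_gt0 : 0 < rho ^+ 2 by exact: lt_le_trans rhoA_ge1.
have [z zA rhoE] : exists2 z : R[i],
    eigenvalue (map_mx (real_complex R) A) z & rho = Normc.normc z.
  apply: spectral_radius_attained.
  by apply: contraTneq rho2_gt0; rewrite -/rho => ->; rewrite expr0n ltxx.
have [a [b [ab0 aA bA]]] := eigenvalue_real_imag zA.
have rho2E : rho ^+ 2 = complex.Re z ^+ 2 + complex.Im z ^+ 2.
  by rewrite rhoE; case: (z) => x y /=; rewrite sqr_sqrtr // addr_ge0 ?sqr_ge0.
have [_ W0] := W_psd; have [_ V0] := V_psd; have [_ Sigma00] := Sigma0_psd.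
have P0 : form_ge0 Pbar0.
  apply: form_ge0_lim Pbar0_lim; elim=> [//|t IH].
  apply: form_ge0_meas_update => //; first exact: (innovation_unit t).
  exact: form_ge0_cov_step.
pose S := sqrtmx W; rewrite -/S in AW_ctrl.
pose kappa := sqfrob (a *m S) + sqfrob (b *m S).
have gain j : sqfrob (a *m (A ^+ j *m S)) + sqfrob (b *m (A ^+ j *m S)) =
    rho ^+ (2 * j) * kappa.
  by rewrite (sqfrob_eigen_iter _ _ aA bA) -rho2E -exprM.
(* If [kappa] vanished, [gain] would make [a] and [b] annihilate every [A ^+ j *m S], and
   controllability would force both to be zero. *)
have kappa_gt0 : 0 < kappa.
  rewrite lt0r addr_ge0 ?sqfrob_ge0 // andbT; apply: contraTneq ab0 => kappa0.
  have zero j : a *m (A ^+ j *m S) = 0 /\ b *m (A ^+ j *m S) = 0.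
    have /eqP := gain j; rewrite kappa0 mulr0 paddr_eq0 ?sqfrob_ge0 //.
    by case/andP => /eqP/sqfrob_eq0 ? /eqP/sqfrob_eq0.
  rewrite (controllable_left_kernel AW_ctrl (fun j => (zero j).1)).
  by rewrite (controllable_left_kernel AW_ctrl (fun j => (zero j).2)) eqxx.
(* When W has no psd square root, sqrtmx W is its default value 0, which
   kappa_gt0 excludes. *)
have [S_sym SS] : S^T = S /\ S *m S = W.
  have [ex|nex] := pselect (exists T : 'M[R]_n, psdmx T /\ T *m T = W).
    by have [[]] := xgetPex (0 : 'M[R]_n) ex.
  move: kappa_gt0; rewrite /kappa (_ : S = 0).
    by rewrite !mulmx0 sqfrob_tr mul0mx mxtrace0 addr0 ltxx.
  by apply: xgetPN => T TW; apply: nex; exists T.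
pose L := sqfrob a + sqfrob b.
have L_gt0 : 0 < L.
  rewrite lt0r addr_ge0 ?sqfrob_ge0 // andbT; apply: contraTneq ab0 => /eqP.
  rewrite paddr_eq0 ?sqfrob_ge0 // => /andP[/eqP/sqfrob_eq0 ->].
  by move=> /eqP/sqfrob_eq0 ->; rewrite eqxx.
(* The oldest noise term after i + 1 steps carries only the i-th power of [A]; dividing by
   [rho ^+ 2] absorbs this shift. *)
exists 1, (kappa / L / rho ^+ 2); split=> //; first by rewrite !divr_gt0.
case=> [//|i] _; rewrite mulnS exprD mulrA divfK ?gt_eqF //.
have frobE : sqfrob (A ^+ i *m S) = \tr (A ^+ i *m W *m (A ^+ i)^T).
  by rewrite sqfrob_tr trmx_mul S_sym -SS !mulmxA.
apply: (@le_trans _ _ (sqfrob (A ^+ i *m S))).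
  (* Once [L] is cleared, [gain] splits the left side into the contributions of [a] and [b], each
     bounded by [sqfrob_row_mul]. *)
  rewrite mulrAC ler_pdivrMr // mulrC -gain [_ * L]mulrC mulrDl.
  by rewrite lerD // sqfrob_row_mul.
rewrite frobE -subr_ge0 /est_error -linearB /=.
exact: form_ge0_tr (form_ge0_iter_cov_step _ _ W0 P0).
Qed.
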